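(* Let $n\ge 1$ be an integer and $0<s<1$. The fractional Laplacean is the Euler–Lagrange operator of the functional $u\mapsto\mathscr E_{(s)}(u)$: given $u\in\mathscr S(\mathbb R^n)$, for every $\varphi\in\mathscr S(\mathbb R^n)$ $$\frac{d}{dt}\,\mathscr E_{(s)}(u+t\varphi)\Big|_{t=0}=\int_{\mathbb R^n}(-\Delta)^s u(x)\,\varphi(x)\,dx .$$ In particular, $u$ is a critical point of $\mathscr E_{(s)}$ (i.e. the left-hand side vanishes for every $\varphi\in\mathscr S(\mathbb R^n)$) if and only if $(-\Delta)^s u=0$.
   Context: $\mathscr S(\mathbb R^n)$ is the Schwartz space. For $u\in\mathscr S(\mathbb R^n)$, $$(-\Delta)^s u(x)=\frac{\gamma(n,s)}{2}\int_{\mathbb R^n}\frac{2u(x)-u(x+y)-u(x-y)}{|y|^{n+2s}}\,dy,\qquad \gamma(n,s)=\frac{s\,2^{2s}\,\Gamma\left(\frac{n+2s}{2}\right)}{\pi^{n/2}\,\Gamma(1-s)},$$ and the nonlocal $s$-energy is $$\mathscr E_{(s)}(u)=\frac{\gamma(n,s)}{4}\int_{\mathbb R^n}\int_{\mathbb R^n}\frac{(u(x)-u(y))^2}{|x-y|^{n+2s}}\,dy\,dx .$$ *)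

(* Defs.v *)
From HB Require Import structures.
From mathcomp Require Import all_boot all_order all_algebra.
From mathcomp Require Import all_classical all_reals all_analysis.

Set Implicit Arguments.
Unset Strict Implicit.
Unset Printing Implicit Defensive.

Import Order.TTheory GRing.Theory Num.Theory.
Import numFieldNormedType.Exports.

Local Open Scope classical_set_scope.
Local Open Scope ring_scope.

(* The sigma-algebra on R^n is the one generated by the coordinate maps, as the
   library does for tuples; over the reals this is the Borel sigma-algebra. *)
Section measurable_rV.
Context {d : measure_display} {T : sigmaRingType d}.
Variable n : nat.

Let coors : 'I_n -> 'rV[T]_n -> T := fun i x => x ord0 i.

Let rV_set0 : g_sigma_preimage coors set0.
Proof. exact: sigma_algebra0. Qed.

Let rV_setC A : g_sigma_preimage coors A -> g_sigma_preimage coors (~` A).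
Proof. exact: sigma_algebraC. Qed.

Let rV_bigcup (F : (set _)^nat) : (forall i, g_sigma_preimage coors (F i)) ->
  g_sigma_preimage coors (\bigcup_i (F i)).
Proof. exact: sigma_algebra_bigcup. Qed.

HB.instance Definition _ := @isMeasurable.Build (measure_tuple_display d)
  'rV[T]_n (g_sigma_preimage coors) rV_set0 rV_setC rV_bigcup.

End measurable_rV.

Lemma measurable_coord d (T : sigmaRingType d) n (i : 'I_n) :
  measurable_fun [set: 'rV[T]_n] (fun x : 'rV[T]_n => x ord0 i).
Proof.
move=> _ Y mY; rewrite setTI; apply: sub_sigma_algebra => /=.
rewrite -bigcup_seq/=; exists i => /=; first by rewrite mem_index_enum.
by exists Y => //; rewrite setTI.
Qed.

Lemma measurable_fun_rV d1 d2 (T1 : measurableType d1) (T2 : measurableType d2)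
    n (f : T1 -> 'rV[T2]_n) :
  (forall i, measurable_fun [set: T1] (fun x => f x ord0 i)) ->
  measurable_fun [set: T1] f.
Proof.
move=> mf _ Y mY; rewrite setTI.
pose F := [set A : set 'rV[T2]_n | measurable (f @^-1` A)].
have sF : sigma_algebra setT F.
  split; rewrite /F /=.
  - by rewrite preimage_set0.
  - by move=> A mA; rewrite setTD preimage_setC; exact: measurableC.
  - by move=> A mA; rewrite preimage_bigcup; exact: bigcup_measurable.
apply: (mY F); split => // A.
rewrite -bigcup_seq/= => -[i /= _ [B mB <-]].
rewrite /F /= setTI -[X in measurable X]setTI; exact: mf.
Qed.

Section lebesgue_rV.
Context {R : realType}.

Definition cons_rV n (p : measurableTypeR R * 'rV[R]_n) :
  'rV[R]_n.+1 :=
  \row_i if unlift ord0 i is Some j then p.2 ord0 j else p.1.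

Definition uncons_rV n (x : 'rV[R]_n.+1) :
    measurableTypeR R * 'rV[R]_n :=
  (x ord0 ord0, \row_j x ord0 (lift ord0 j)).

Lemma cons_rVK n : cancel (@cons_rV n) (@uncons_rV n).
Proof.
move=> [a x]; rewrite /uncons_rV mxE unlift_none /=; congr pair.
by apply/rowP => j; rewrite !mxE liftK.
Qed.

Lemma measurable_cons_rV n : measurable_fun setT (@cons_rV n).
Proof.
apply: measurable_fun_rV => i.
case: (unliftP ord0 i) => [j|] ->.
- under eq_fun do rewrite mxE liftK.
  exact: (measurableT_comp (measurable_coord j) measurable_snd).
- under eq_fun do rewrite mxE unlift_none.
  exact: measurable_fst.
Qed.

Lemma measurable_uncons_rV n : measurable_fun setT (@uncons_rV n).
Proof.
apply: measurable_fun_pair => /=; first exact: measurable_coord.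
apply: measurable_fun_rV => i.
under eq_fun do rewrite mxE.
exact: measurable_coord.
Qed.

Section step.
Variable n : nat.
Variable mu : {sigma_finite_measure set 'rV[R]_n -> \bar R}.

Definition cons_measure : set 'rV[R]_n.+1 -> \bar R :=
  pushforward (lebesgue_measure \x mu)%E (@cons_rV n).

Let cons_measure0 : cons_measure set0 = 0%E.
Proof. by rewrite /cons_measure /pushforward preimage_set0 measure0. Qed.

Let cons_measure_ge0 A : (0 <= cons_measure A)%E.
Proof. exact: (measure_ge0 (lebesgue_measure \x mu)%E). Qed.

Let cons_measure_sigma_additive : semi_sigma_additive cons_measure.
Proof.
have mpre A : measurable A -> measurable (@cons_rV n @^-1` A).
  by move=> mA; rewrite -[X in measurable X]setTI; exact: measurable_cons_rV.
move=> F mF tF mUF; rewrite /cons_measure /pushforward preimage_bigcup.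
apply: measure_semi_sigma_additive.
- by move=> k; exact: mpre.
- apply/trivIsetP => /= i j _ _ ij; rewrite -preimage_setI.
  by move/trivIsetP : tF => /(_ _ _ _ _ ij) ->//; rewrite preimage_set0.
- by rewrite -preimage_bigcup; exact: mpre.
Qed.

HB.instance Definition _ := isMeasure.Build _ _ _ cons_measure
  cons_measure0 cons_measure_ge0 cons_measure_sigma_additive.

Let cons_measure_sigma_finite : sigma_finite setT cons_measure.
Proof.
have /sigma_finiteP[F [FT ndF Foo]] := sigma_finiteT (@lebesgue_measure R).
have /sigma_finiteP[G [GT ndG Goo]] := sigma_finiteT mu.
exists (fun k => @uncons_rV n @^-1` (F k `*` G k)).
  rewrite -preimage_bigcup -[LHS](preimage_setT (@uncons_rV n)).
  congr (_ @^-1` _); rewrite -setXTT FT GT predeqE => -[x y]; split.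
    move=> [/= [k _ Fkx] [l _ Gly]]; exists (maxn k l) => //; split.
    - by move: x Fkx; exact/subsetPset/ndF/leq_maxl.
    - by move: y Gly; exact/subsetPset/ndG/leq_maxr.
  by move=> [k _ []/= ? ?]; split; exists k.
move=> k; have [mFk Fk] := Foo k; have [mGk Gk] := Goo k; split.
  rewrite -[X in measurable X]setTI; apply: measurable_uncons_rV => //.
  exact: measurableX.
rewrite /cons_measure /pushforward -comp_preimage.
rewrite (_ : _ \o _ = id); last by apply/funext => x /=; rewrite cons_rVK.
by rewrite preimage_id product_measure1E// lte_mul_pinfty// ge0_fin_numE.
Qed.

HB.instance Definition _ := Measure_isSigmaFinite.Build _ _ _ cons_measure
  cons_measure_sigma_finite.

End step.

(* Lebesgue measure on R^n, by R^0 = {0} and R^(n+1) = R x R^n. *)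
Fixpoint lebesgue_rV n :
    {sigma_finite_measure set 'rV[R]_n -> \bar R} :=
  if n is k.+1 then cons_measure (lebesgue_rV k) else @dirac _ 'rV[R]_0 0 R.

Lemma lebesgue_rV_box n (A : 'I_n -> set (measurableTypeR R)) :
  (forall i, measurable (A i)) ->
  lebesgue_rV n [set x | forall i, A i (x ord0 i)] =
  (\prod_(i < n) lebesgue_measure (A i))%E.
Proof.
elim: n A => [|n IH] A mA.
  rewrite big_ord0 /= diracE mem_set//= => -[] //.
rewrite big_ord_recl /= -IH// -product_measure1E//.
  rewrite /cons_measure /pushforward; congr product_measure1.
  apply/seteqP; split => -[a x] /=.
    move=> h; split => [|i].
      by have := h ord0; rewrite mxE unlift_none.
    by have := h (lift ord0 i); rewrite mxE liftK.
  move=> [h0 h] i; rewrite mxE.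
  by case: unliftP => [j|] ->.
set B := (X in measurable X).
have -> : B = \bigcap_(i in [set: 'I_n])
    ((fun x : 'rV[R]_n => x ord0 i) @^-1` A (lift ord0 i)).
  by apply/seteqP; split => x /= h i; [move=> _; exact: h | exact: h].
apply: fin_bigcap_measurable => // i _.
rewrite -[X in measurable X]setTI.
by apply: measurable_coord => //; exact: mA.
Qed.

End lebesgue_rV.

Section fractional_laplacean.
Context {R : realType}.

(* Euclidean norm: the library's norm on 'rV[R]_n is the sup norm. *)
Definition enorm n (x : 'rV[R]_n) : R := Num.sqrt (\sum_i x ord0 i ^+ 2).

(* Euler's Gamma function; the integral converges for z > 0. *)
Definition Gamma (z : R) : R :=
  \int[lebesgue_measure]_(t in `]0, +oo[) (t `^ (z - 1) * expR (- t)).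

(* The iterated partial derivative d_i1 (d_i2 (... u)) for l = [:: i1; i2; ...]. *)
Definition partials n (l : seq 'I_n) (u : 'rV[R]_n -> R) : 'rV[R]_n -> R :=
  foldr (fun i f => 'D_(delta_mx ord0 i) f) u l.

Definition smooth n (u : 'rV[R]_n -> R) : Prop :=
  forall l : seq 'I_n, continuous (partials l u) /\
    forall i x, derivable (partials l u) x (delta_mx ord0 i).

(* Real-valued Schwartz functions. *)
Definition schwartz n (u : 'rV[R]_n -> R) : Prop :=
  smooth u /\
  forall (k : nat) (l : seq 'I_n), exists C : R, forall x,
    (1 + enorm x ^+ 2) ^+ k * `|partials l u x| <= C.

Definition gamma_ns (n : nat) (s : R) : R :=
  s * 2 `^ (2 * s) * Gamma ((n%:R + 2 * s) / 2) /
  (pi `^ (n%:R / 2) * Gamma (1 - s)).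

(* At y = 0, and at x = y in [energy], the integrand is 0 / 0 = 0; this affects
   only a null set, since n >= 1. *)
Definition frac_lap_integrand n (s : R) (u : 'rV[R]_n -> R) (x y : 'rV[R]_n) : R :=
  (2 * u x - u (x + y) - u (x - y)) / enorm y `^ (n%:R + 2 * s).

Definition frac_lap n (s : R) (u : 'rV[R]_n -> R) (x : 'rV[R]_n) : R :=
  gamma_ns n s / 2 * \int[lebesgue_rV n]_y frac_lap_integrand s u x y.

Definition energy n (s : R) (u : 'rV[R]_n -> R) : \bar R :=
  ((gamma_ns n s / 4)%:E *
   \int[lebesgue_rV n]_x \int[lebesgue_rV n]_y
     ((u x - u y) ^+ 2 / enorm (x - y) `^ (n%:R + 2 * s))%:E)%E.

(* d/dt E(u + t phi) at t = 0 exists and equals l: as E takes values in [0, +oo],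
   this includes finiteness near t = 0. *)
Definition is_energy_variation n (s : R) (u phi : 'rV[R]_n -> R) (l : R) : Prop :=
  (\forall t \near (0 : R), energy s (fun x => u x + t * phi x) \is a fin_num) /\
  is_derive (0 : R) (1 : R) (fun t => fine (energy s (fun x => u x + t * phi x))) l.

Definition critical_point n (s : R) (u : 'rV[R]_n -> R) : Prop :=
  forall phi, schwartz phi -> is_energy_variation s u phi 0.

End fractional_laplacean.

(* Main.v *)
Require Import Defs.
From mathcomp Require Import all_boot all_order all_algebra.
From mathcomp Require Import all_classical all_reals all_analysis.
From mathcomp Require Import measurable_realfun.
From mathcomp Require Import ring lra.

Import Order.TTheory GRing.Theory Num.Theory.
Import numFieldNormedType.Exports.

Local Open Scope classical_set_scope.
Local Open Scope ring_scope.

(* Write K(z) = |z|^-(n+2s), D_z u(x) = 2u(x) - u(x+z) - u(x-z), and let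
   B(u, v) be the integral of D_z u(x) v(x) K(z) over pairs (x, z).  It
   converges absolutely: |D_z u(x)| <= C min(1, |z|^2) uniformly in x, the weight
   min(1, |z|^2) K(z) is integrable by summing over dyadic shells, and v is
   integrable.  For fixed z, translation invariance gives
     int D_z u(x) v(x) dx = 2 c(0) - c(z) - c'(z),
   with c(z) = int u(x+z) v(x) dx and c' the same with u, v exchanged; hence B is
   symmetric.  For v = u this is also int (u(x) - u(x+z))^2 dx, so by Tonelli the
   energy is (gamma/4) B(u, u), while by Fubini (gamma/2) B(u, v) is the integral
   of (-Delta)^s u times v.  The energy of u + t phi is thus a quadratic polynomial
   in t with linear coefficient (gamma/2) B(u, phi).
   If u is critical, the choice phi = u yields gamma = 0 or B(u, u) = 0; in the
   second case u is constant and every D_z u vanishes. *)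

(** * Measurability and translation invariance on R^n *)

Section rV_measure.
Context {R : realType}.

Lemma measurable_rV_box n (A : 'I_n -> set (measurableTypeR R)) :
  (forall i, measurable (A i)) ->
  measurable [set x : 'rV[R]_n | forall i, A i (x ord0 i)].
Proof.
move=> mA.
rewrite (_ : [set _ | _] = \bigcap_(i in [set: 'I_n])
    ((fun x : 'rV[R]_n => x ord0 i) @^-1` A i)); last first.
  by apply/seteqP; split => x /= h i; [move=> _; exact: h | exact: h].
apply: fin_bigcap_measurable => // i _.
rewrite -[X in measurable X]setTI.
by apply: measurable_coord => //; exact: mA.
Qed.

(* Rational boxes form a countable base of the topology. *)
Lemma open_measurable_rV n (U : set 'rV[R]_n) : open U -> measurable U.
Proof.
move=> oU.
pose B (p : 'rV[rat]_n * nat) := [set x : 'rV[R]_n |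
   forall i, (ball (ratr (p.1 ord0 i) : R) (p.2.+1%:R^-1 : R)) (x ord0 i)].
have mB p : measurable (B p).
  apply: (@measurable_rV_box _
    (fun i => ball (ratr (p.1 ord0 i) : R) (p.2.+1%:R^-1 : R))) => i.
  exact: measurable_ball.
rewrite (_ : U = \bigcup_(p in [set p | B p `<=` U]) B p); last first.
  apply/seteqP; split; last by move=> x [p] /= pU; exact: pU.
  move=> x Ux.
  have /nbhs_ballP[e /= e0 xeU] : nbhs x U by exact: open_nbhs_nbhs.
  (* Half-width below [e / 2]: a box that contains [x] then lies in the sup-norm ball of radius [e]
     around [x], by passing through its rational centre. *)
  have [k /= ke] : exists k : nat, k.+1%:R^-1 < e / 2.
    have [|k] := @ltr_add_invr R 0 (e / 2); first by rewrite divr_gt0.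
    by rewrite add0r; exists k.
  have k0 : 0 < (k.+1%:R^-1 : R) by rewrite invr_gt0.
  have /choice[q hq] : forall i : 'I_n, exists q : rat,
      ball (ratr q : R) (k.+1%:R^-1 : R) (x ord0 i).
    move=> i.
    have /rat_in_itvoo[q] : x ord0 i - k.+1%:R^-1 < x ord0 i + k.+1%:R^-1.
      by rewrite ltrD2l gtrN.
    rewrite in_itv /= => /andP[h1 h2]; exists q.
    by rewrite /ball /= ltr_distl h1.
  exists (\row_i q i, k) => /=; last by move=> i; rewrite mxE; exact: hq.
  move=> y /= By; apply: xeU; split => // i j; rewrite (ord1 i).
  have := By j; rewrite /= mxE => h1; have h2 := hq j.
  by apply: (ball_splitr (z := ratr (q j) : R)); exact: (le_ball (ltW ke)).
rewrite bigcup_mkcond; apply: countable_bigcupT_measurable => [|p].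
  exact: countableP.
by case: ifP => // _; exact: mB.
Qed.

Lemma continuous_measurable_rV n (f : 'rV[R]_n -> R) :
  continuous f -> measurable_fun setT f.
Proof.
move=> cf; apply: (measurability _ (RGenOpens.measurableE R)).
move=> _ [_ [a [b ->] <-]]; rewrite setTI.
apply: open_measurable_rV; move/continuousP : cf; apply; exact: itv_open.
Qed.

Lemma measurable_rVD n : measurable_fun setT
  (fun p : 'rV[R]_n * 'rV[R]_n => p.1 + p.2).
Proof.
apply: measurable_fun_rV => i.
under eq_fun do rewrite mxE.
by apply: measurable_funD; apply: measurableT_comp (measurable_coord i) _.
Qed.

Lemma measurable_rVB n : measurable_fun setT
  (fun p : 'rV[R]_n * 'rV[R]_n => p.1 - p.2).
Proof.
apply: measurable_fun_rV => i.
under eq_fun do rewrite !mxE.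
by apply: measurable_funB; apply: measurableT_comp (measurable_coord i) _.
Qed.

Lemma measurable_shift_rV n (a : 'rV[R]_n) :
  measurable_fun setT (fun x : 'rV[R]_n => x + a).
Proof.
exact: (measurableT_comp (measurable_rVD n) (measurable_pair2 a)).
Qed.

Lemma measurable_enorm n : measurable_fun setT (@enorm R n).
Proof.
have ms : measurable_fun setT (@Num.sqrt R).
  apply: continuous_measurable_fun => x; exact: sqrt_continuous.
apply: (measurableT_comp ms).
by apply: measurable_sum => i; apply: measurable_funX; exact: measurable_coord.
Qed.

(** The pushforward of Lebesgue measure under the translation gives every half-open interval its
    length, so uniqueness identifies the two measures. *)
Lemma ge0_integral_lebesgue_shift (f : R -> \bar R) (a : R) :
  measurable_fun setT f -> (forall x, 0 <= f x)%E ->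
  (\int[lebesgue_measure]_x f (x + a)%R = \int[lebesgue_measure]_x f x)%E.
Proof.
move=> mf f0.
have mT : measurable_fun setT
    (fun x : measurableTypeR R => (x + a)%R : measurableTypeR R).
  exact: measurable_funD.
transitivity (\int[pushforward lebesgue_measure
   (fun x : measurableTypeR R => (x + a)%R : measurableTypeR R)]_x f x)%E.
  by rewrite ge0_integral_pushforward.
apply: eq_measure_integral => //= A mA AS.
apply/esym/(@lebesgue_measure_unique R
  [the {measure set (measurableTypeR R) -> \bar R} of pushforward lebesgue_measure
     (fun x : measurableTypeR R => x + a : measurableTypeR R)]) => //.
move=> _ [[b c]] _ <-.
rewrite /= /pushforward (_ : _ @^-1` _ = `]b - a, c - a]%classic).
  by rewrite !lebesgue_measure_itv /= !lte_fin ltrD2r -!EFinD opprB addrA subrK.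
by apply/seteqP; split => x /=; rewrite !in_itv /= ltrBlDr lerBrDr.
Qed.

(** Tonelli through the pushforward that defines [lebesgue_rV]; this is the inductive step for
    arguments on the dimension. *)
Lemma ge0_integral_rV_cons n (f : 'rV[R]_n.+1 -> \bar R) :
  measurable_fun setT f -> (forall x, 0 <= f x)%E ->
  (\int[lebesgue_rV n.+1]_x f x =
   \int[lebesgue_measure]_a \int[lebesgue_rV n]_x f (cons_rV (a, x)))%E.
Proof.
move=> mf f0.
rewrite (ge0_integral_pushforward (measurable_cons_rV (n:=n))) //.
rewrite preimage_setT fubini_tonelli1 //; last by move=> x; exact: f0.
exact: (measurableT_comp mf (measurable_cons_rV (n:=n))).
Qed.

(** Induction on the dimension: the inner integral absorbs the last coordinates of [a], and
    one-dimensional invariance absorbs the first one. *)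
Lemma ge0_integral_rV_shift n (f : 'rV[R]_n -> \bar R) (a : 'rV[R]_n) :
  measurable_fun setT f -> (forall x, 0 <= f x)%E ->
  (\int[lebesgue_rV n]_x f (x + a)%R = \int[lebesgue_rV n]_x f x)%E.
Proof.
elim: n f a => [|n IH] f a mf f0.
  by apply: eq_integral => x _; congr f; apply/rowP => -[].
have mfc : measurable_fun setT (f \o @cons_rV R n).
  exact: (measurableT_comp mf (measurable_cons_rV (n:=n))).
have mfa : measurable_fun setT (fun x : 'rV[R]_n.+1 => f (x + a)).
  exact: (measurableT_comp mf (measurable_shift_rV _ a)).
rewrite !ge0_integral_rV_cons //.
transitivity (\int[lebesgue_measure]_b \int[lebesgue_rV n]_x
    f (cons_rV ((b + a ord0 ord0)%R, x)))%E.
  apply: eq_integral => b _.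
  rewrite -(IH (fun x => f (cons_rV (b + a ord0 ord0, x)))
              (\row_j a ord0 (lift ord0 j))) //; last first.
    exact: (measurableT_comp mfc
      (measurable_pair1 (b + a ord0 ord0 : measurableTypeR R))).
  apply: eq_integral => x _; congr f; apply/rowP => i; rewrite !mxE /=.
  by case: (unliftP ord0 i) => [j|] -> //; rewrite !mxE.
rewrite (ge0_integral_lebesgue_shift
  (fun b => \int[lebesgue_rV n]_x f (cons_rV (b, x)))%E) //.
  apply: (measurable_fun_fubini_tonelli_F (m2 := lebesgue_rV n)
    (f \o @cons_rV R n)) => // x.
  exact: f0.
by move=> b; exact: integral_ge0.
Qed.

Lemma integral_rV_shift n (f : 'rV[R]_n -> \bar R) (a : 'rV[R]_n) :
  measurable_fun setT f ->
  (\int[lebesgue_rV n]_x f (x + a)%R = \int[lebesgue_rV n]_x f x)%E.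
Proof.
move=> mf; rewrite integralE [RHS]integralE.
congr (_ - _)%E.
  rewrite -(ge0_integral_rV_shift n (f^\+)%E a) //; last exact: measurable_funepos.
  by apply: eq_integral => x _; rewrite !funeposE.
rewrite -(ge0_integral_rV_shift n (f^\-)%E a) //; last exact: measurable_funeneg.
by apply: eq_integral => x _; rewrite !funenegE.
Qed.

Lemma integrable_rV_shift n (f : 'rV[R]_n -> \bar R) (a : 'rV[R]_n) :
  (lebesgue_rV n).-integrable setT f ->
  (lebesgue_rV n).-integrable setT (fun x : 'rV[R]_n => f (x + a)).
Proof.
move=> /integrableP[mf foo]; apply/integrableP; split.
  exact: (measurableT_comp mf (measurable_shift_rV _ a)).
rewrite (ge0_integral_rV_shift n (abse \o f)) //; first exact: measurableT_comp.
by move=> x; exact: abse_ge0.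
Qed.

End rV_measure.

(** * Dyadic integrability *)

Section dyadic.
Context {R : realType}.

(** Cubes stand in for Euclidean balls because their measure is explicit; [enorm_cube] puts the ball
    inside the cube. *)
Definition cube n (r : R) : set 'rV[R]_n :=
  [set x | forall i, `[- r, r]%classic (x ord0 i)].

Lemma measurable_cube n (r : R) : measurable (@cube n r).
Proof. exact: (measurable_rV_box _ (fun=> `[- r, r]%classic)). Qed.

Lemma lebesgue_cube n (r : R) : 0 <= r ->
  lebesgue_rV n (@cube n r) = ((2 * r) ^+ n)%:E.
Proof.
move=> r0; rewrite (lebesgue_rV_box (A := fun=> `[- r, r]%classic)) //.
under eq_bigr do rewrite lebesgue_measure_itv /= lte_fin.
have -> : (if - r < r then (r%:E - (- r)%:E)%E else 0%E) = (2 * r)%:E.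
  case: ifPn => [_|]; first by rewrite -EFinB; congr EFin; lra.
  by rewrite -leNgt => rr; congr EFin; lra.
rewrite prodEFin; congr EFin.
by rewrite prodr_const card_ord.
Qed.

Lemma abs_le_enorm n (x : 'rV[R]_n) i : `|x ord0 i| <= enorm x.
Proof.
rewrite -sqrtr_sqr ler_wsqrtr // (bigD1 i) //= lerDl sumr_ge0 // => j _.
exact: sqr_ge0.
Qed.

Lemma enorm_ge0 n (x : 'rV[R]_n) : 0 <= enorm x.
Proof. exact: sqrtr_ge0. Qed.

Lemma enorm_cube n (x : 'rV[R]_n) (r : R) : enorm x <= r -> cube n r x.
Proof.
by move=> xr i; rewrite /= in_itv /= -ler_norml (le_trans (abs_le_enorm _ _ _)).
Qed.

Lemma enorm_gt0 n (x : 'rV[R]_n) : x != 0 -> 0 < enorm x.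
Proof.
move=> x0; rewrite lt_neqAle enorm_ge0 andbT; apply: contra x0 => /eqP xe.
apply/eqP/rowP => i; rewrite mxE; apply/eqP.
by rewrite -normr_le0 xe abs_le_enorm.
Qed.

(** [k.+1] is the least exponent whose power of two exceeds [r]; that exponent is nonzero because
    [1 <= r]. *)
Lemma dyadic_shell (r : R) : 1 <= r -> exists k, 2 ^+ k <= r < 2 ^+ k.+1.
Proof.
move=> r1.
have hex : exists m, r < 2 ^+ m.
  exists (Num.truncn r).+1; apply: (lt_trans (truncnS_gt _)).
  by rewrite -natrX ltr_nat ltn_expl.
case: (ex_minnP hex) => -[|k] hk kmin.
  by move: hk; rewrite expr0 ltNge r1.
exists k; rewrite hk andbT leNgt; apply/negP => /kmin.
by rewrite ltnn.
Qed.

(** [f] lies below the sum of [c k] times the indicator of the [k]-th cube. Integrated term by term,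
    this sum is dominated by a geometric series. The cubes may overlap, since a single term already
    dominates [f] at a given point. *)
Lemma integrable_dyadic n (f : 'rV[R]_n -> R) (c r : R^nat) (A q : R) :
  measurable_fun setT f -> (forall k, 0 <= c k) -> (forall k, 0 <= r k) ->
  0 < q < 1 -> (forall k, c k * (2 * r k) ^+ n <= A * q ^+ k) ->
  (forall z, 0 <= f z) ->
  (forall z, f z != 0 -> exists k, cube n (r k) z /\ f z <= c k) ->
  (lebesgue_rV n).-integrable setT (EFin \o f).
Proof.
move=> mf c0 r0 /andP[q0 q1] crA f0 fcr.
apply/integrableP; split; first exact/measurable_EFinP.
pose g k z := (c k * \1_(cube n (r k)) z)%:E.
have g0 k z : (0 <= g k z)%E by rewrite lee_fin mulr_ge0.
have mg k : measurable_fun setT (g k).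
  apply/measurable_EFinP; apply: measurable_funM => //.
  by apply: measurable_indic; exact: measurable_cube.
apply: (@le_lt_trans _ _ (\int[lebesgue_rV n]_z \sum_(k <oo) g k z)%E).
  apply: ge0_le_integral => //=.
  - by apply/measurable_EFinP; exact: measurableT_comp.
  - by apply: ge0_emeasurable_sum => // *; exact: g0.
  move=> z _; rewrite ger0_norm //.
  have [->|/fcr[k [zk fk]]] := eqVneq (f z) 0.
    by apply: nneseries_ge0 => *; exact: g0.
  apply: (@le_trans _ _ (g k z)).
    by rewrite lee_fin indicE mem_set // mulr1.
  rewrite (@nneseriesD1 _ (g ^~ z) k) // leeDl //.
  by apply: nneseries_ge0 => *; exact: g0.
rewrite integral_nneseries //.
apply: (@le_lt_trans _ _ (\sum_(k <oo) (A * q ^+ k)%:E)%E).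
  apply: lee_nneseries => [k _ _|k _]; first exact: integral_ge0.
  rewrite /g; under eq_integral do rewrite EFinM.
  rewrite ge0_integralZl_EFin //; last first.
    by apply/measurable_EFinP; apply: measurable_indic; exact: measurable_cube.
  rewrite integral_indic //; last exact: measurable_cube.
  rewrite setIT [X in (_ * X)%E](_ : _ = ((2 * r k) ^+ n)%:E);
    last exact: lebesgue_cube.
  by rewrite -EFinM lee_fin.
apply: (@le_lt_trans _ _ (A * (1 - q)^-1)%:E); last exact: ltry.
(* The growth bound at index 0 forces [A] to be nonnegative, which makes the partial sums increase
   to the limit. *)
have A0 : 0 <= A.
  have := crA 0; rewrite expr0 mulr1; apply: le_trans.
  by rewrite mulr_ge0 // exprn_ge0 // mulr_ge0.
apply: lime_le.
  apply: is_cvg_nneseries => k _ _.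
  by rewrite lee_fin mulr_ge0 // exprn_ge0 // ltW.
apply: nearW => m; rewrite sumEFin lee_fin.
by apply: (@geometric_le_lim R m A q) => //; rewrite ger0_norm // ltW.
Qed.

(** * Integrability of the kernel weight *)

Definition riesz_weight n (s : R) (z : 'rV[R]_n) : R :=
  Num.min 1 (enorm z ^+ 2) / enorm z `^ (n%:R + 2 * s).

Lemma measurable_powR_inv n (p : R) :
  measurable_fun setT (fun z : 'rV[R]_n => (enorm z `^ p)^-1).
Proof.
under eq_fun do rewrite -powRN.
exact: (measurableT_comp (measurable_powR _) (measurable_enorm n)).
Qed.

Lemma measurable_riesz_weight n s : measurable_fun setT (riesz_weight n s).
Proof.
apply: measurable_funM; last exact: measurable_powR_inv.
apply: measurable_minr => //; apply: measurable_funX; exact: measurable_enorm.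
Qed.

Lemma riesz_weight_ge0 n s (z : 'rV[R]_n) : 0 <= riesz_weight n s z.
Proof.
by rewrite divr_ge0 ?powR_ge0 // le_min ler01 sqr_ge0.
Qed.

Lemma expr4_sqr k : 4 ^+ k = (2 ^+ k) ^+ 2 :> R.
Proof. by rewrite -exprM mulnC exprM (_ : 2 ^+ 2 = 4) // expr2 -natrM. Qed.

Lemma powR_pow2 n (s : R) k :
  (2 ^+ k) `^ (n%:R + 2 * s) = (2 ^+ n * 2 `^ (2 * s)) ^+ k :> R.
Proof.
have -> : 2 ^+ n * 2 `^ (2 * s) = 2 `^ (n%:R + 2 * s) :> R.
  by rewrite powRD ?powR_mulrn // pnatr_eq0 implybT.
by rewrite -(powR_mulrn k (powR_ge0 _ _)) powRAC powR_mulrn.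
Qed.

(** On the shell 2^k <= |z| < 2^(k+1) the weight is at most 2^(-k(n+2s)), and the enclosing cube has
    volume 4^n 2^(kn). The ratio 2^(-2s) is below 1 because s > 0. *)
Lemma integrable_riesz_weight_far n (s : R) : 0 < s ->
  (lebesgue_rV n).-integrable setT
    (EFin \o (fun z : 'rV[R]_n => if 1 <= enorm z then riesz_weight n s z else 0)).
Proof.
move=> s0; set Q := 2 `^ (2 * s) : R.
have Q1 : 1 < Q.
  have /(_ 1 2) := gt0_ltr_powR (mulr_gt0 (ltr0n R 2) s0).
  by rewrite powR1; apply; rewrite ?nnegrE ?ltr1n.
have Q0 : 0 < Q by exact: (lt_trans ltr01).
apply: (@integrable_dyadic n _ (fun k => ((2 ^+ n * Q) ^+ k)^-1)
   (fun k => 2 ^+ k.+1) (4 ^+ n) Q^-1).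
- apply: measurable_fun_ifT => //; last exact: measurable_riesz_weight.
  by apply: measurable_fun_ler => //; exact: measurable_enorm.
- by move=> k; rewrite invr_ge0 exprn_ge0 // mulr_ge0 ?exprn_ge0 // ltW.
- by move=> k; rewrite exprn_ge0.
- by rewrite invr_gt0 Q0 invf_lt1.
- move=> k.
  rewrite exprMn -exprM mulnC exprM invfM exprVn mulrAC ler_wpM2r //.
    by rewrite invr_ge0 exprn_ge0 // ltW.
  rewrite -(exprVn _ n) -exprMn !exprS (_ : _ * _ = 4) //.
  by field; rewrite expf_neq0.
- by move=> z; case: ifP => // _; rewrite riesz_weight_ge0.
move=> z; case: (leP 1 (enorm z)) => z1; last by rewrite eqxx.
move=> _; have [k /andP[k1 k2]] := dyadic_shell _ z1.
exists k; split; first by apply: enorm_cube; exact: ltW.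
rewrite /riesz_weight -[leRHS]mul1r ler_pM ?invr_ge0 ?powR_ge0 //.
- by rewrite le_min ler01 sqr_ge0.
- by rewrite ge_min lexx.
rewrite -powR_pow2.
rewrite lef_pV2 ?posrE ?powR_gt0 ?exprn_gt0 //; last exact: lt_le_trans z1.
by rewrite ge0_ler_powR ?nnegrE ?exprn_ge0 ?enorm_ge0 //
  addr_ge0 // mulr_ge0 // ltW.
Qed.

(** The shells are those of 1/|z|. Where 2^k <= 1/|z| < 2^(k+1), the numerator is at most 4^(-k) and
    the kernel at most 2^((k+1)(n+2s)). The ratio 2^(2s)/4 is below 1 because s < 1. *)
Lemma integrable_riesz_weight_near n (s : R) : 0 < s < 1 ->
  (lebesgue_rV n).-integrable setT
    (EFin \o (fun z : 'rV[R]_n => if 1 <= enorm z then 0 else riesz_weight n s z)).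
Proof.
move=> /andP[s0 s1]; set Q := 2 `^ (2 * s) : R.
have Q4 : Q < 4.
  rewrite /Q (_ : 4 = 2 `^ (2 * s) * 2 `^ (2 * (1 - s))); last first.
    rewrite -powRD; last by rewrite pnatr_eq0 implybT.
    by rewrite -mulrDr addrC subrK mulr1 powR_mulrn // expr2 -natrM.
  rewrite ltr_pMr ?powR_gt0 //.
  have s1' : 0 < 2 * (1 - s) by rewrite mulr_gt0 // subr_gt0.
  have /(_ 1 2) := gt0_ltr_powR s1'.
  by rewrite powR1; apply; rewrite ?nnegrE ?ltr1n.
have Q0 : 0 < Q by rewrite powR_gt0.
apply: (@integrable_dyadic n _ (fun k => (4 ^+ k)^-1 * (2 ^+ n * Q) ^+ k.+1)
   (fun k => (2 ^+ k)^-1) (4 ^+ n * Q) (Q / 4)).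
- apply: measurable_fun_ifT => //; last exact: measurable_riesz_weight.
  by apply: measurable_fun_ler => //; exact: measurable_enorm.
- by move=> k; rewrite mulr_ge0 ?invr_ge0 ?exprn_ge0 // mulr_ge0 ?exprn_ge0 // ltW.
- by move=> k; rewrite invr_ge0 exprn_ge0.
- by rewrite divr_gt0 // ltr_pdivrMr // mul1r Q4.
- move=> k.
  rewrite (_ : _ * _ = 4 ^+ n * Q * (Q / 4) ^+ k) //.
  rewrite !exprMn !exprVn -!exprM mulnS exprD (mulnC n k) exprS.
  rewrite (_ : 4 ^+ n = 2 ^+ n * 2 ^+ n :> R); last first.
    by rewrite -exprMn -natrM.
  by field; rewrite !expf_neq0.
- by move=> z; case: ifP => // _; rewrite riesz_weight_ge0.
move=> z; case: (leP 1 (enorm z)) => z1; first by rewrite eqxx.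
move=> wz.
(* At the origin the minimum in the numerator is 0, so a nonzero weight excludes that point. *)
have z0 : 0 < enorm z.
  apply: enorm_gt0; apply: contra wz => /eqP ->.
  rewrite /riesz_weight (_ : enorm 0 = 0) ?expr0n ?min_r ?mul0r //.
  by rewrite /enorm big1 ?sqrtr0 // => i _; rewrite mxE expr0n.
have [|k /andP[k1 k2]] := @dyadic_shell (enorm z)^-1.
  by rewrite invf_ge1 // ltW.
have k1' : enorm z <= (2 ^+ k)^-1.
  by rewrite -[enorm z]invrK lef_pV2 ?posrE ?invr_gt0 ?exprn_gt0.
have k2' : (2 ^+ k.+1)^-1 <= enorm z.
  by rewrite -[enorm z]invrK lef_pV2 ?posrE ?invr_gt0 ?exprn_gt0 // ltW.
exists k; split; first exact: enorm_cube.
rewrite /riesz_weight ler_pM ?invr_ge0 ?powR_ge0 //.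
- by rewrite le_min ler01 sqr_ge0.
- rewrite ge_min; apply/orP; right.
  have -> : (4 ^+ k)^-1 = ((2 ^+ k)^-1) ^+ 2 :> R.
    by rewrite exprVn -expr4_sqr.
  by rewrite lerXn2r ?nnegrE ?invr_ge0 ?exprn_ge0 ?enorm_ge0.
rewrite -powR_pow2 -[leRHS]invrK lef_pV2 ?posrE ?invr_gt0 ?powR_gt0 ?exprn_gt0 //.
rewrite -powRN -mulN1r powRrM powR_inv1 ?exprn_ge0 //.
by rewrite ge0_ler_powR ?nnegrE ?invr_ge0 ?exprn_ge0 ?enorm_ge0 //
  addr_ge0 // mulr_ge0 // ltW.
Qed.

Lemma integrable_riesz_weight n (s : R) : 0 < s < 1 ->
  (lebesgue_rV n).-integrable setT (EFin \o riesz_weight n s).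
Proof.
move=> /andP[s0 s1].
have h := integrableD measurableT (integrable_riesz_weight_far n s s0)
  (integrable_riesz_weight_near n s ltac:(by rewrite s0)).
apply: eq_integrable h => // z _ /=.
by case: ifP => _; rewrite -EFinD ?addr0 ?add0r.
Qed.

(** The majorant for Schwartz functions: a decay of order 2(n+1) against a volume growth of order n
    leaves the ratio 2^n / 4^(n+1). *)
Lemma integrable_inv_pow n :
  (lebesgue_rV n).-integrable setT
    (EFin \o (fun x : 'rV[R]_n => ((1 + enorm x ^+ 2) ^+ n.+1)^-1)).
Proof.
have pos (x : 'rV[R]_n) : 1 <= 1 + enorm x ^+ 2 by rewrite lerDl sqr_ge0.
(* Index 0 serves the unit ball and index k+1 the shell 2^k <= |z| < 2^(k+1); the factor [4 ^+ n.+1]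
   compensates for this shift. *)
apply: (@integrable_dyadic n _ (fun k => 4 ^+ n.+1 / (4 ^+ k) ^+ n.+1)
   (fun k => 2 ^+ k) (4 ^+ n.+1 * 2 ^+ n) (2 ^+ n / 4 ^+ n.+1)).
- have md : measurable_fun setT (fun x : 'rV[R]_n => 1 + enorm x ^+ 2).
    apply: measurable_funD => //.
    by apply: measurable_funX; exact: measurable_enorm.
  rewrite (_ : (fun _ => _) = fun x : 'rV[R]_n =>
      (1 + enorm x ^+ 2) `^ (- n.+1%:R)).
    exact: (measurableT_comp (measurable_powR _) md).
  by apply/funext => x; rewrite powR_invn // (le_trans ler01).
- by move=> k; rewrite divr_ge0 ?exprn_ge0.
- by move=> k; rewrite exprn_ge0.
- rewrite divr_gt0 ?exprn_gt0 //= ltr_pdivrMr ?exprn_gt0 // mul1r exprS.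
  have h : 2 ^+ n <= 4 ^+ n :> R by rewrite lerXn2r ?nnegrE ?ler_nat.
  have h1 : 0 < 4 ^+ n :> R by rewrite exprn_gt0.
  by apply: (le_lt_trans h); rewrite ltr_pMl // ltr1n.
- move=> k; rewrite !exprMn !exprVn -!exprM (mulnC k n) (mulnC k n.+1).
  by rewrite mulrACA [_^-1 * _]mulrC.
- by move=> z; rewrite invr_ge0 exprn_ge0 // (le_trans ler01).
move=> z _.
have [z1|z1] := leP 1 (enorm z); last first.
  exists 0; split; first by apply: enorm_cube; rewrite expr0 ltW.
  rewrite expr0 expr1n divr1; apply: (@le_trans _ _ 1).
    by rewrite invf_le1 ?exprn_gt0 ?exprn_ege1 // (lt_le_trans ltr01).
  by rewrite exprn_ege1 // ler1n.
have [k /andP[k1 k2]] := dyadic_shell _ z1.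
exists k.+1; split; first by apply: enorm_cube; exact: ltW.
have -> : 4 ^+ n.+1 / (4 ^+ k.+1) ^+ n.+1 = ((4 ^+ k) ^+ n.+1)^-1 :> R.
  by rewrite (exprS _ k) exprMn invfM mulrA divff ?mul1r // expf_neq0.
have p1 : 0 < 1 + enorm z ^+ 2 by apply: lt_le_trans (pos z).
rewrite lef_pV2 ?posrE ?exprn_gt0 // lerXn2r ?nnegrE ?exprn_ge0 ?(ltW p1) //.
rewrite expr4_sqr; apply: (@le_trans _ _ (enorm z ^+ 2)); last by rewrite lerDr.
by rewrite lerXn2r ?nnegrE ?exprn_ge0 ?enorm_ge0.
Qed.

End dyadic.

(** * Second differences *)

Section mean_value.
Context {R : realType}.
Variable n : nat.
Implicit Types (f u : 'rV[R]_n -> R) (a v x y : 'rV[R]_n).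

(** The two difference quotients are the same function of [h], since [h *: 1] is [h] in the scalar
    field. *)
Lemma is_derive_line f a v (t : R) : derivable f (a + t *: v) v ->
  is_derive t 1 (fun r => f (a + r *: v)) ('D_v f (a + t *: v)).
Proof.
move=> df.
have E : (fun h : R => h^-1 *: (((fun r => f (a + r *: v)) \o shift t) (h *: 1)
    - f (a + t *: v))) =
  (fun h : R => h^-1 *: ((f \o shift (a + t *: v)) (h *: v) - f (a + t *: v))).
  apply/funext => h /=; congr (_ *: (f _ - _)).
  have -> : h *: (1 : R) = h by exact: mulr1.
  by rewrite scalerDl addrCA.
apply: DeriveDef; first by rewrite /derivable E.
by rewrite /derive E.
Qed.

Lemma derivable_shift_arg f x y v : derivable f (x + y) v ->
  derivable (fun p => f (p + y)) x v.
Proof.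
rewrite /derivable; under eq_fun do rewrite /= addrA.
done.
Qed.

Lemma derive_shift_arg f x y v : 'D_v (fun p => f (p + y)) x = 'D_v f (x + y).
Proof.
rewrite /derive /=.
have -> : (fun h : R => h^-1 *: (f (h *: v + x + y) - f (x + y))) =
  (fun h => h^-1 *: (f (h *: v + (x + y)) - f (x + y))).
  by apply/funext => h; rewrite addrA.
by [].
Qed.

Lemma line_lipschitz f a v M : (forall x, derivable f x v) ->
  (forall x, `|'D_v f x| <= M) ->
  forall t : R, `|f (a + t *: v) - f a| <= M * `|t|.
Proof.
move=> df fM t.
pose g (r : R) := f (a + r *: v).
have dg (r : R) : is_derive r (1 : R) g ('D_v f (a + r *: v)) by exact: is_derive_line.
have cg : continuous g.
  by move=> r; apply: differentiable_continuous; apply/derivable1_diffP.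
have mvt (p q : R) : p <= q -> `|g q - g p| <= M * `|q - p|.
  move=> pq.
  have [|c _ ->] := @MVT_segment R g (fun r => 'D_v f (a + r *: v)) p q pq
    (fun r _ => dg r).
    exact: continuous_subspaceT.
  by rewrite normrM ler_wpM2r.
have -> : f a = g 0 by rewrite /g scale0r addr0.
have [t0|t0] := leP 0 t; first by have := mvt 0 t t0; rewrite subr0.
by have := mvt t 0 (ltW t0); rewrite distrC sub0r normrN.
Qed.

(** The path from [x] to [x + y] changes one coordinate at a time. Each leg is parallel to an axis,
    so partial derivatives control it, and the increments telescope. *)
Lemma partials_lipschitz f M :
  (forall i x, derivable f x (delta_mx ord0 i)) ->
  (forall i x, `|'D_(delta_mx ord0 i) f x| <= M) ->
  forall x y, `|f (x + y) - f x| <= M * \sum_i `|y ord0 i|.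
Proof.
move=> df fM x y.
(* The first [k] coordinates of [y], followed by zeros: the vertices of the path. *)
pose h (k : nat) : 'rV[R]_n := \row_j if (j < k)%N then y ord0 j else 0.
have h0 : h 0%N = 0 by apply/rowP => j; rewrite !mxE.
have hn : h n = y by apply/rowP => j; rewrite !mxE ltn_ord.
have hS (i : 'I_n) : h i.+1 = h i + y ord0 i *: delta_mx ord0 i.
  apply/rowP => j; rewrite !mxE eqxx /= ltnS leq_eqVlt.
  have [->|ji] := eqVneq j i; first by rewrite eqxx ltnn add0r mulr1.
  by rewrite (negbTE (ji : (j : nat) != i)) mulr0 addr0.
have -> : f (x + y) - f x = \sum_(i < n) (f (x + h i.+1) - f (x + h i)).
  rewrite -(big_mkord predT (fun i => f (x + h i.+1) - f (x + h i))).
  by rewrite telescope_sumr // h0 hn addr0.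
rewrite mulr_sumr; apply: (le_trans (ler_norm_sum _ _ _)).
apply: ler_sum => i _; rewrite hS addrA.
exact: line_lipschitz.
Qed.

(** The second difference is the increment by [- y] of w(p) = u(p+y) - u(p). The partials of w are
    increments of those of [u], so the Lipschitz bound is applied twice. *)
Lemma second_difference_le u M : 0 <= M ->
  (forall i x, derivable u x (delta_mx ord0 i)) ->
  (forall i j x, derivable ('D_(delta_mx ord0 i) u) x (delta_mx ord0 j)) ->
  (forall i j x, `|'D_(delta_mx ord0 j) ('D_(delta_mx ord0 i) u) x| <= M) ->
  forall x y, `|2 * u x - u (x + y) - u (x - y)| <= M * (\sum_i `|y ord0 i|) ^+ 2.
Proof.
move=> M0 du ddu uM x y.
pose w p := u (p + y) - u p.
have dw i p : derivable w p (delta_mx ord0 i).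
  by apply: derivableB => //; apply: derivable_shift_arg.
have Dw i p : 'D_(delta_mx ord0 i) w p =
    'D_(delta_mx ord0 i) u (p + y) - 'D_(delta_mx ord0 i) u p.
  by rewrite deriveB ?derive_shift_arg //; apply: derivable_shift_arg.
have Dw_le i p : `|'D_(delta_mx ord0 i) w p| <= M * \sum_j `|y ord0 j|.
  by rewrite Dw; exact: (partials_lipschitz ('D_(delta_mx ord0 i) u) M (ddu i) (uM i)).
have := partials_lipschitz w _ dw Dw_le x (- y).
under [X in _ <= _ * X -> _]eq_bigr do rewrite mxE normrN.
rewrite -mulrA -expr2; congr (_ <= _); rewrite /w subrK.
by congr (`|_|); ring.
Qed.

Lemma sum_abs_le_enorm y : \sum_i `|y ord0 i| <= n%:R * enorm y.
Proof.
apply: (@le_trans _ _ (\sum_(i < n) enorm y)).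
  by apply: ler_sum => i _; exact: abs_le_enorm.
by rewrite sumr_const card_ord mulr_natl.
Qed.

(* The only properties of Schwartz functions that the theorem depends on. *)
Definition tame u : Prop := [/\ measurable_fun setT u,
  (lebesgue_rV n).-integrable setT (EFin \o u) &
  exists C : R, [/\ 0 <= C, forall x, `|u x| <= C &
    forall x z, `|2 * u x - u (x + z) - u (x - z)| <= C * Num.min 1 (enorm z ^+ 2)]].

Lemma schwartz_tame u : schwartz u -> tame u.
Proof.
move=> [su bu].
have mu : measurable_fun setT u.
  by apply: continuous_measurable_rV; exact: (su [::]).1.
have [B hB] := bu 0%N [::].
have uB x : `|u x| <= B by have := hB x; rewrite expr0 mul1r.
have B0 : 0 <= B by exact: le_trans (uB 0).
split => //.
  have [C hC] := bu n.+1 [::].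
  have iC := integrableZl measurableT C (@integrable_inv_pow R n).
  apply: le_integrable iC => //; first exact/measurable_EFinP.
  move=> x _ /=; rewrite lee_fin.
  have p : 0 < (1 + enorm x ^+ 2) ^+ n.+1.
    by rewrite exprn_gt0 // ltr_wpDr // sqr_ge0.
  apply: le_trans (ler_norm _).
  by rewrite ler_pdivlMr // mulrC; exact: hC.
have [D hD] : exists D : 'I_n * 'I_n -> R, forall ij x,
    `|partials [:: ij.2; ij.1] u x| <= D ij.
  have /choice[D hD] : forall ij : 'I_n * 'I_n, exists d : R, forall x,
      `|partials [:: ij.2; ij.1] u x| <= d; last by exists D.
  move=> ij; have [d hd] := bu 0%N [:: ij.2; ij.1].
  by exists d => x; have := hd x; rewrite expr0 mul1r.
(* Summing over all pairs of indices gives one bound for every second partial derivative. *)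
pose M := \sum_ij `|D ij|.
have M0 : 0 <= M by exact: sumr_ge0.
have uM (i j : 'I_n) x :
    `|'D_(delta_mx ord0 j) ('D_(delta_mx ord0 i) u) x| <= M.
  apply: (le_trans (hD (i, j) x)); apply: (le_trans (ler_norm _)).
  by rewrite /M (bigD1 (i, j)) //= lerDl sumr_ge0.
have sd := second_difference_le _ _ M0 (su [::]).2 (fun i => (su [:: i]).2) uM.
(* [4 * B] is the crude bound from the four values of [u], used for large [z]; the other term is the
   second-order bound, with the sum of the coordinates replaced by n|z|. *)
exists (4 * B + M * n%:R ^+ 2); split.
- by rewrite addr_ge0 // ?mulr_ge0 // exprn_ge0.
- move=> x; apply: (le_trans (uB x)); rewrite -[leLHS]mul1r.
  rewrite ler_wpDr // ?ler_wpM2r ?ler1n //; first by rewrite mulr_ge0 ?exprn_ge0.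
move=> x z.
rewrite minEle; case: ifP => _.
  rewrite mulr1 ler_wpDr ?mulr_ge0 ?exprn_ge0 //.
  have := uB x; have := uB (x + z); have := uB (x - z).
  rewrite !ler_norml => /andP[a1 a2] /andP[b1 b2] /andP[c1 c2].
  by apply/andP; split; lra.
apply: (le_trans (sd x z)).
rewrite mulrDl ler_wpDl //; first by rewrite !mulr_ge0 // enorm_ge0.
rewrite -mulrA ler_wpM2l // -exprMn lerXn2r ?nnegrE ?sumr_ge0 //.
- by rewrite mulr_ge0 // enorm_ge0.
- exact: sum_abs_le_enorm.
Qed.

End mean_value.

(** * Correlations *)

Section correlation.
Context {R : realType}.
Variable n : nat.
Implicit Types (u v : 'rV[R]_n -> R) (x y z : 'rV[R]_n).
Local Notation mu := (@lebesgue_rV R n).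

Lemma measurable_tame u : tame n u -> measurable_fun setT u.
Proof. by case. Qed.

Lemma integrable_tame u : tame n u -> mu.-integrable setT (EFin \o u).
Proof. by case. Qed.

Lemma tame_shift u z : tame n u -> tame n (fun x => u (x + z)).
Proof.
move=> [mu' iu [C [C0 uC sC]]]; split.
- exact: (measurableT_comp mu' (measurable_shift_rV _ z)).
- exact: integrable_rV_shift _ _ z iu.
- exists C; split => // x y; have := sC (x + z) y.
  by rewrite !(addrAC _ z).
Qed.

Lemma integrable_tameM u v : tame n u -> tame n v ->
  mu.-integrable setT (EFin \o (fun x => u x * v x)).
Proof.
move=> [mu' _ [C [C0 uC _]]] [mv iv _].
apply: le_integrable (integrableZl measurableT C iv) => //.
  by apply/measurable_EFinP; exact: measurable_funM.
move=> x _ /=; rewrite lee_fin !normrM (ger0_norm C0).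
by rewrite ler_wpM2r.
Qed.

Lemma tameD u v (t : R) : tame n u -> tame n v -> tame n (fun x => u x + t * v x).
Proof.
move=> [mu' iu [C [C0 uC sC]]] [mv iv [D [D0 vD sD]]]; split.
- by apply: measurable_funD => //; exact: measurable_funM.
- have := integrableD measurableT iu (integrableZl measurableT t iv).
  by apply: eq_integrable => // x _ /=; rewrite EFinD EFinM.
- exists (C + `|t| * D); split; first by rewrite addr_ge0 // mulr_ge0.
    move=> x; apply: (le_trans (ler_normD _ _)).
    by rewrite lerD // normrM ler_wpM2l.
  move=> x z; rewrite [leRHS]mulrDl /=.
  have -> : 2 * (u x + t * v x) - (u (x + z) + t * v (x + z))
      - (u (x - z) + t * v (x - z)) = (2 * u x - u (x + z) - u (x - z)) +
      t * (2 * v x - v (x + z) - v (x - z)) by ring.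
  apply: (le_trans (ler_normD _ _)).
  by rewrite lerD // normrM -mulrA ler_wpM2l.
Qed.

Definition correlation u v z : R := \int[mu]_x (u (x + z) * v x).

Lemma Rintegral_rV_shift (f : 'rV[R]_n -> R) z : measurable_fun setT f ->
  \int[mu]_x f (x + z) = \int[mu]_x f x.
Proof.
move=> mf; congr fine; apply: (integral_rV_shift n (EFin \o f)).
exact/measurable_EFinP.
Qed.

(** Substitute [x + z] for [x]. *)
Lemma correlationN u v z : tame n u -> tame n v ->
  correlation u v (- z) = correlation v u z.
Proof.
move=> tu tv; rewrite /correlation -(Rintegral_rV_shift _ z).
  by apply: eq_Rintegral => x _; rewrite addrK mulrC.
apply: measurable_funM; last exact: measurable_tame.
exact: (measurable_tame _ (tame_shift _ _ tu)).
Qed.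

Lemma correlation0 u v : correlation u v 0 = \int[mu]_x (u x * v x).
Proof. by apply: eq_Rintegral => x _; rewrite addr0. Qed.

Lemma integral_second_difference u v z : tame n u -> tame n v ->
  \int[mu]_x ((2 * u x - u (x + z) - u (x - z)) * v x) =
  2 * correlation u v 0 - correlation u v z - correlation v u z.
Proof.
move=> tu tv; rewrite -(correlationN u v) // correlation0.
have i0 := integrable_tameM _ _ tu tv.
have i1 := integrable_tameM _ _ (tame_shift _ z tu) tv.
have i2 := integrable_tameM _ _ (tame_shift _ (- z) tu) tv.
rewrite -RintegralZl // -RintegralB //; last exact: (integrableZl measurableT 2 i0).
rewrite -RintegralB //; last first.
  exact: (integrableB measurableT (integrableZl measurableT 2 i0) i1).
by apply: eq_Rintegral => x _; ring.
Qed.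

(** Expanding the square and shifting u(x+z)^2 back yields the right-hand side of
    [integral_second_difference] for [v] equal to [u]. This links the energy to the operator. *)
Lemma integral_sqr_difference u z : tame n u ->
  \int[mu]_x ((u x - u (x + z)) ^+ 2) =
  2 * correlation u u 0 - correlation u u z - correlation u u z.
Proof.
move=> tu; have tz := tame_shift _ z tu.
have i0 := integrable_tameM _ _ tu tu.
have i1 := integrable_tameM _ _ tz tu.
have i2 := integrable_tameM _ _ tz tz.
have E : correlation u u 0 = \int[mu]_x (u (x + z) * u (x + z)).
  rewrite correlation0 (Rintegral_rV_shift (fun x => u x * u x)) //.
  by apply: measurable_funM; exact: measurable_tame.
have -> : 2 * correlation u u 0 = correlation u u 0 + correlation u u 0 by ring.
rewrite [X in _ + X - _ - _]E correlation0 -RintegralD //.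
rewrite -RintegralB //; last exact: (integrableD measurableT i0 i2).
rewrite -RintegralB //; last first.
  exact: (integrableB measurableT (integrableD measurableT i0 i2) i1).
by apply: eq_Rintegral => x _; ring.
Qed.

End correlation.

(** * The bilinear form of the energy *)

Lemma integrable_tensor d1 d2 (T1 : measurableType d1) (T2 : measurableType d2)
    (R : realType) (m1 : {sigma_finite_measure set T1 -> \bar R})
    (m2 : {sigma_finite_measure set T2 -> \bar R}) (f : T1 -> R) (g : T2 -> R) :
  m1.-integrable setT (EFin \o f) -> m2.-integrable setT (EFin \o g) ->
  (m1 \x m2)%E.-integrable setT (EFin \o (fun q => f q.1 * g q.2)).
Proof.
move=> /integrableP[/measurable_EFinP mf foo] /integrableP[/measurable_EFinP mg goo].
have mh : measurable_fun setT (EFin \o (fun q : T1 * T2 => f q.1 * g q.2)).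
  apply/measurable_EFinP; apply: measurable_funM.
    exact: (measurableT_comp mf measurable_fst).
  exact: (measurableT_comp mg measurable_snd).
apply/(integrable12ltyP m1 m2 mh).
have h x : (\int[m2]_y `|(EFin \o (fun q : T1 * T2 => (f q.1 * g q.2)%R)) (x, y)| =
    `|(f x)%:E| * \int[m2]_y `|(EFin \o g) y|)%E.
  rewrite -ge0_integralZl //; last exact/measurable_EFinP/measurableT_comp.
  by apply: eq_integral => y _ /=; rewrite normrM EFinM.
under eq_integral do rewrite h.
rewrite ge0_integralZr //; last 2 first.
- exact/measurable_EFinP/measurableT_comp.
- exact: integral_ge0.
by rewrite lte_mul_pinfty // ?ge0_fin_numE // integral_ge0.
Qed.

Section pairing.
Context {R : realType}.
Variables (n : nat) (s : R).
Hypothesis s01 : 0 < s < 1.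
Implicit Types (u v : 'rV[R]_n -> R) (x y z : 'rV[R]_n).
Local Notation mu := (@lebesgue_rV R n).

Lemma frac_lap_integrand_le u : tame n u -> exists C : R, forall x z,
  `|frac_lap_integrand s u x z| <= C * riesz_weight n s z.
Proof.
move=> [_ _ [C [C0 _ uC]]]; exists C => x z.
rewrite normrM (ger0_norm (x := _^-1)) ?invr_ge0 ?powR_ge0 //.
by rewrite mulrA ler_wpM2r // invr_ge0 powR_ge0.
Qed.

Lemma measurable_frac_lap_integrand u : measurable_fun setT u ->
  measurable_fun setT
    (fun q : 'rV[R]_n * 'rV[R]_n => frac_lap_integrand s u q.1 q.2).
Proof.
move=> mu'; apply: measurable_funM; last first.
  exact: (measurableT_comp (measurable_powR_inv n _) measurable_snd).
apply: measurable_funB; first apply: measurable_funB.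
- by apply: measurable_funM => //; exact: (measurableT_comp mu' measurable_fst).
- exact: (measurableT_comp mu' (measurable_rVD n)).
- exact: (measurableT_comp mu' (measurable_rVB n)).
Qed.

Lemma integrable_frac_lap_integrand u x : tame n u ->
  mu.-integrable setT (EFin \o frac_lap_integrand s u x).
Proof.
move=> tu; have [C uC] := frac_lap_integrand_le _ tu.
have iw := integrableZl measurableT C (integrable_riesz_weight n s s01).
apply: le_integrable iw => //.
  apply/measurable_EFinP.
  exact: (measurableT_comp (measurable_frac_lap_integrand _ (measurable_tame _ _ tu))
    (measurable_pair1 x)).
by move=> z _ /=; rewrite lee_fin (le_trans (uC x z)) // ler_norm.
Qed.

Definition pair_integrand u v (q : 'rV[R]_n * 'rV[R]_n) : R :=
  frac_lap_integrand s u q.1 q.2 * v q.1.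

(** The form B of the overview, taken over the product measure so that either variable can be
    integrated first. *)
Definition pairing u v : R := \int[(mu \x mu)%E]_q pair_integrand u v q.

Lemma integrable_pair_integrand u v : tame n u -> tame n v ->
  (mu \x mu)%E.-integrable setT (EFin \o pair_integrand u v).
Proof.
move=> tu tv; have [C uC] := frac_lap_integrand_le _ tu.
have it := integrable_tensor _ _ _ _ _ _ _ _ _ (integrable_tame _ _ tv)
  (integrable_riesz_weight n s s01).
apply: le_integrable (integrableZl measurableT C it) => //.
  apply/measurable_EFinP; apply: measurable_funM.
    exact: measurable_frac_lap_integrand (measurable_tame _ _ tu).
  exact: (measurableT_comp (measurable_tame _ _ tv) measurable_fst).
move=> [x z] _ /=; rewrite lee_fin /pair_integrand /= mulrCA normrM [leRHS]normrM.
by rewrite mulrC ler_wpM2l // (le_trans (uC x z)) // ler_norm.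
Qed.

(** Fubini with [z] integrated first: the inner integral is the fractional Laplacean up to its
    constant. *)
Lemma integrable_fst_pairing u v : tame n u -> tame n v ->
  mu.-integrable setT (fun x => (frac_lap s u x * v x)%:E) /\
  \int[mu]_x (frac_lap s u x * v x) = gamma_ns n s / 2 * pairing u v.
Proof.
move=> tu tv.
have E x : (frac_lap s u x * v x)%:E =
   ((gamma_ns n s / 2)%:E * \int[mu]_z (pair_integrand u v (x, z))%:E)%E.
  rewrite /frac_lap -mulrA EFinM; congr (_ * _)%E.
  rewrite -RintegralZr ?fineK //; last exact: integrable_frac_lap_integrand.
  apply: integrable_fin_num => //.
  have := integrableZr measurableT (v x) (integrable_frac_lap_integrand _ x tu).
  by apply: eq_integrable.
have ip := integrable_pair_integrand _ _ tu tv.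
have iF := integrable_fubini_F ip.
split.
  by apply: eq_integrable (integrableZl measurableT (gamma_ns n s / 2) iF).
rewrite /Rintegral.
under eq_integral do rewrite E.
rewrite integralZl // fineM //; last exact: integrable_fin_num.
by rewrite (integral12_prod_meas1 ip).
Qed.

(** Fubini with [x] integrated first: the inner integral becomes an expression in correlations, from
    which symmetry can be read off. *)
Lemma pairing_second u v : tame n u -> tame n v ->
  (\int[mu]_z ((2 * correlation n u v 0 - correlation n u v z - correlation n v u z)
     / enorm z `^ (n%:R + 2 * s))%:E = (pairing u v)%:E)%E.
Proof.
move=> tu tv.
have ip := integrable_pair_integrand _ _ tu tv.
rewrite /pairing /Rintegral fineK; last exact: integrable_fin_num.
rewrite -(integral21_prod_meas1 ip).
apply: eq_integral => z _.
rewrite -integral_second_difference // mulrC.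
have it : mu.-integrable setT
    (EFin \o (fun x => (2 * u x - u (x + z) - u (x - z)) * v x)).
  have i0 := integrable_tameM _ _ _ tu tv.
  have i1 := integrable_tameM _ _ _ (tame_shift _ _ z tu) tv.
  have i2 := integrable_tameM _ _ _ (tame_shift _ _ (- z) tu) tv.
  have := integrableB measurableT
    (integrableB measurableT (integrableZl measurableT 2 i0) i1) i2.
  apply: eq_integrable => // x _ /=.
  by rewrite -EFinM -!EFinB; congr EFin; ring.
rewrite -RintegralZl // fineK.
  apply: eq_integral => x _; congr EFin.
  by rewrite /pair_integrand /frac_lap_integrand /= mulrAC mulrC.
apply: integrable_fin_num => //.
have := integrableZl measurableT (enorm z `^ (n%:R + 2 * s))^-1 it.
by apply: eq_integrable.
Qed.

Lemma pairingC u v : tame n u -> tame n v -> pairing u v = pairing v u.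
Proof.
move=> tu tv; apply: EFin_inj.
rewrite -(pairing_second u v tu tv) -(pairing_second v u tv tu).
apply: eq_integral => z _; congr ((_ / _)%:E).
have -> : correlation n u v 0 = correlation n v u 0.
  by rewrite !correlation0; apply: eq_Rintegral => x _; rewrite mulrC.
ring.
Qed.

Lemma pairing_quadratic u v (t : R) : tame n u -> tame n v ->
  let w x := u x + t * v x in
  pairing w w = pairing u u + t * (2 * pairing u v) + t ^+ 2 * pairing v v.
Proof.
move=> tu tv /=.
have ipu := integrable_pair_integrand _ _ tu tu.
have ipv := integrable_pair_integrand _ _ tv tv.
have iuv := integrable_pair_integrand _ _ tu tv.
have ivu := integrable_pair_integrand _ _ tv tu.
have -> : 2 * pairing u v = pairing u v + pairing v u.
  by rewrite (pairingC v) //; ring.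
rewrite /pairing -RintegralD // -RintegralZl //; last first.
  exact: (integrableD measurableT iuv ivu).
have i1 := integrableZl measurableT t (integrableD measurableT iuv ivu).
have i2 := integrableZl measurableT (t ^+ 2) ipv.
rewrite -RintegralZl // -RintegralD //.
rewrite -RintegralD //; last exact: (integrableD measurableT ipu i1).
apply: eq_Rintegral => q _; rewrite /pair_integrand /frac_lap_integrand.
ring.
Qed.

(** * The energy as a quadratic form *)

Lemma enormN x : enorm (- x) = enorm x.
Proof. by congr Num.sqrt; apply: eq_bigr => i _; rewrite mxE sqrrN. Qed.

Definition sqr_integrand v (q : 'rV[R]_n * 'rV[R]_n) : R :=
  (v q.1 - v q.2) ^+ 2 / enorm (q.1 - q.2) `^ (n%:R + 2 * s).

Lemma measurable_sqr_integrand v : measurable_fun setT v ->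
  measurable_fun setT (sqr_integrand v).
Proof.
move=> mv; apply: measurable_funM; last first.
  exact: (measurableT_comp (measurable_powR_inv n _) (measurable_rVB n)).
apply: measurable_funX; apply: measurable_funB.
  exact: (measurableT_comp mv measurable_fst).
exact: (measurableT_comp mv measurable_snd).
Qed.

Lemma sqr_integrand_ge0 v q : 0 <= sqr_integrand v q.
Proof. by rewrite divr_ge0 ?sqr_ge0 ?powR_ge0. Qed.

(** The substitution y = z + x and the exchange of integrals rest on positivity alone, so finiteness
    of the energy is a conclusion, inherited from the pairing. *)
Lemma integral_sqr_integrand v : tame n v ->
  (\int[mu]_x \int[mu]_y (sqr_integrand v (x, y))%:E = (pairing v v)%:E)%E.
Proof.
move=> tv; have mv := measurable_tame _ _ tv.
have me := measurable_sqr_integrand _ mv.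
pose e (q : 'rV[R]_n * 'rV[R]_n) := (sqr_integrand v (q.1, q.2 + q.1))%:E.
have mshear : measurable_fun setT (fun q : 'rV[R]_n * 'rV[R]_n => (q.1, q.2 + q.1)).
  apply: measurable_fun_pair => //.
  exact: (measurableT_comp (measurable_rVD n)
    (measurable_fun_pair measurable_snd measurable_fst)).
transitivity (\int[mu]_x \int[mu]_z e (x, z))%E.
  apply: eq_integral => x _.
  apply/esym/(ge0_integral_rV_shift n (fun y => (sqr_integrand v (x, y))%:E) x).
    by apply/measurable_EFinP; exact: (measurableT_comp me (measurable_pair1 x)).
  by move=> y; rewrite lee_fin sqr_integrand_ge0.
rewrite fubini_tonelli; last 2 first.
- by apply/measurable_EFinP; exact: (measurableT_comp me mshear).
- by move=> q; rewrite lee_fin sqr_integrand_ge0.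
rewrite -pairing_second //; apply: eq_integral => z _.
rewrite -integral_sqr_difference // mulrC.
have it : mu.-integrable setT (EFin \o (fun x => (v x - v (x + z)) ^+ 2)).
  have tz := tame_shift _ _ z tv.
  have i0 := integrable_tameM _ _ _ tv tv.
  have i1 := integrable_tameM _ _ _ tz tv.
  have i2 := integrable_tameM _ _ _ tz tz.
  have := integrableB measurableT
    (integrableD measurableT i0 i2) (integrableZl measurableT 2 i1).
  apply: eq_integrable => // x _ /=.
  by rewrite -?EFinM -?EFinD -?EFinB; congr EFin; ring.
rewrite -RintegralZl // fineK.
  apply: eq_integral => x _; congr EFin.
  rewrite [RHS]mulrC /e /sqr_integrand /= (addrC z); congr (_ / _ `^ _).
  by rewrite opprD addrA subrr sub0r enormN.
apply: integrable_fin_num => //.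
have := integrableZl measurableT (enorm z `^ (n%:R + 2 * s))^-1 it.
by apply: eq_integrable.
Qed.

Lemma energyE v : tame n v -> energy s v = (gamma_ns n s / 4 * pairing v v)%:E.
Proof.
by move=> tv; rewrite EFinM -integral_sqr_integrand.
Qed.

Lemma is_energy_variation_tame u v : tame n u -> tame n v ->
  is_energy_variation s u v (gamma_ns n s / 2 * pairing u v).
Proof.
move=> tu tv.
have E t : energy s (fun x => u x + t * v x) = (gamma_ns n s / 4 *
    (pairing u u + t * (2 * pairing u v) + t ^+ 2 * pairing v v))%:E.
  by rewrite energyE ?pairing_quadratic //; exact: tameD.
rewrite /is_energy_variation; split.
  by near=> t; rewrite E.
under eq_fun do rewrite E /=.
(* The linear coefficient is gamma/4 times 2 B(u, v), and the quadratic term has derivative 0 at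
   [t = 0]. *)
apply: is_derive_eq.
rewrite /GRing.scale /=; field.
Unshelve. all: by end_near.
Qed.

(** Sup-norm balls are boxes, so [U] contains a box of volume (2e)^n. *)
Lemma open_lebesgue_rV_gt0 (U : set 'rV[R]_n) x : open U -> U x -> (0 < mu U)%E.
Proof.
move=> oU Ux.
have /nbhs_ballP[e /= e0 xeU] : nbhs x U by exact: open_nbhs_nbhs.
pose B := [set y : 'rV[R]_n | forall i, ball (x ord0 i) e (y ord0 i)].
have mB : measurable B.
  by apply: (measurable_rV_box n (fun i => ball (x ord0 i) e)) => i;
    exact: measurable_ball.
have BU : B `<=` U.
  by move=> y By; apply: xeU; split => // i j; rewrite (ord1 i); exact: By.
apply: (@lt_le_trans _ _ (mu B)); last first.
  by apply: le_measure => //; rewrite inE //; exact: open_measurable_rV.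
rewrite [X in (_ < X)%E](_ : _ =
    \prod_(i < n) lebesgue_measure (ball (x ord0 i) e))%E; last first.
  by apply: (lebesgue_rV_box (A := fun i => ball (x ord0 i) e)) => i; exact: measurable_ball.
under eq_bigr do rewrite lebesgue_measure_ball ?ltW //.
rewrite prodEFin lte_fin prodr_gt0 // => i _.
by rewrite mulrn_wgt0.
Qed.

(** By positivity the inner integral vanishes for almost every [x]. For one such [x], [u] equals
    [u x] almost everywhere; the set where it differs is open by continuity and null, hence
    empty. *)
Lemma pairing_eq0 u : continuous u -> tame n u -> pairing u u = 0 ->
  exists c, forall x, u x = c.
Proof.
move=> cu tu u0; have mu' := measurable_tame _ _ tu.
have me := measurable_sqr_integrand _ mu'.
have mE : measurable_fun setT (EFin \o sqr_integrand u) by exact/measurable_EFinP.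
have := integral_sqr_integrand _ tu; rewrite u0 => I0.
pose F x := (\int[mu]_y (sqr_integrand u (x, y))%:E)%E.
have mF : measurable_fun setT F.
  apply: (measurable_fun_fubini_tonelli_F (m2 := mu) (EFin \o sqr_integrand u)) => //.
  by move=> q; rewrite lee_fin sqr_integrand_ge0.
have F0 x : (0 <= F x)%E.
  by apply: integral_ge0 => y _; rewrite lee_fin sqr_integrand_ge0.
have FI : (\int[mu]_x `|F x| = 0)%E.
  by rewrite -[RHS]I0; apply: eq_integral => x _; rewrite gee0_abs.
have [N [mN N0 FN]] := (ae_eq_integral_abs _ measurableT mF).1 FI.
(* A null set is not the whole space, which has positive measure as a nonempty open set. *)
have [x Nx] : exists x, ~ N x.
  apply/existsNP => NT.
  have := @open_lebesgue_rV_gt0 setT 0 openT I.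
  by rewrite (_ : setT = N) ?N0 ?ltxx //; apply/seteqP; split.
have Fx : F x = 0%E by apply: contrapT => h; apply: Nx; apply: FN => /(_ I).
have mx : measurable_fun setT (fun y => (sqr_integrand u (x, y))%:E).
  by apply/measurable_EFinP; exact: (measurableT_comp me (measurable_pair1 x)).
have xI : (\int[mu]_y `|(sqr_integrand u (x, y))%:E| = 0)%E.
  rewrite -[RHS]Fx.
  by apply: eq_integral => y _; rewrite gee0_abs // lee_fin sqr_integrand_ge0.
have [M [mM M0 FM]] := (ae_eq_integral_abs _ measurableT mx).1 xI.
exists (u x) => y; apply/eqP; apply: contrapT => /negP uyx.
pose U := [set y | u y != u x].
have oU : open U.
  have -> : U = u @^-1` [set~ u x] by apply/seteqP; split => z /eqP.
  move/continuousP : cu; apply; rewrite openC; exact: closed_eq.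
(* Where [u z] differs from [u x], the integrand could vanish only through the convention that the
   inverse of 0 is 0. This would force |x-z| = 0, hence [z = x], which contradicts [u z != u x]. *)
have UM : U `<=` M.
  move=> z Uz; apply: FM => /(_ I) /= => -[] /eqP.
  rewrite mulf_eq0 sqrf_eq0 subr_eq0 eq_sym (negbTE Uz) invr_eq0 /=.
  rewrite powR_eq0 => /andP[/eqP xz _].
  move: Uz; rewrite /U /= => /eqP; apply.
  congr u; apply/eqP; rewrite eq_sym -subr_eq0.
  by apply: contrapT => /negP /enorm_gt0; rewrite xz ltxx.
have := open_lebesgue_rV_gt0 _ _ oU uyx.
by rewrite (subset_measure0 _ _ UM M0) ?ltxx //; exact: open_measurable_rV.
Qed.

End pairing.

(** * The Euler-Lagrange equation and critical points *)

Theorem proposition20p5 (R : realType) (n : nat) (s : R) (u : 'rV[R]_n -> R)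
    (hn : (1 <= n)%N) (hs0 : 0 < s) (hs1 : s < 1) (hu : schwartz u) :
  [/\ (* the integrals in the statement converge absolutely *)
      forall x, (lebesgue_rV n).-integrable [set: 'rV[R]_n]
        (EFin \o frac_lap_integrand s u x),
      forall phi, schwartz phi ->
        (lebesgue_rV n).-integrable [set: 'rV[R]_n]
          (fun x => (frac_lap s u x * phi x)%:E),
      (* the Euler-Lagrange operator of the energy *)
      forall phi, schwartz phi ->
        is_energy_variation s u phi
          (\int[lebesgue_rV n]_x (frac_lap s u x * phi x))
    & critical_point s u <-> (forall x, frac_lap s u x = 0)].
Proof.
have s01 : 0 < s < 1 by rewrite hs0.
have tu := schwartz_tame _ _ hu.
have ivar phi : schwartz phi -> is_energy_variation s u phi
    (\int[lebesgue_rV n]_x (frac_lap s u x * phi x)).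
  move=> /schwartz_tame tphi.
  rewrite (integrable_fst_pairing _ _ s01 _ _ tu tphi).2.
  exact: is_energy_variation_tame.
split => //.
- by move=> x; exact: integrable_frac_lap_integrand.
- move=> phi /schwartz_tame tphi.
  exact: (integrable_fst_pairing _ _ s01 _ _ tu tphi).1.
split=> [crit x|fl0 phi sphi]; last first.
  have := ivar _ sphi; congr is_energy_variation.
  under eq_Rintegral do rewrite fl0 mul0r.
  by rewrite /Rintegral integral0.
(* Criticality is tested in the direction [u] itself; uniqueness of the derivative then equates
   gamma/2 B(u, u) with 0. *)
have [_ d0] := crit _ hu.
have [_ d1] := is_energy_variation_tame _ _ s01 _ _ tu tu.
have : gamma_ns n s / 2 * pairing n s u u = 0.
  by rewrite -(@derive_val _ _ _ _ _ _ _ d1) (@derive_val _ _ _ _ _ _ _ d0).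
(* Either the constant is 0, and then [frac_lap] vanishes through its prefactor, or B(u, u) = 0 and
   [u] is constant. *)
move/eqP; rewrite mulf_eq0 /frac_lap => /orP[/eqP ->|/eqP uu0]; first by rewrite mul0r.
have [c uc] : exists c, forall x, u x = c.
  exact: (pairing_eq0 _ _ s01 _ (hu.1 [::]).1 tu uu0).
have f0 y : frac_lap_integrand s u x y = 0.
  by rewrite /frac_lap_integrand !uc (_ : 2 * c - c - c = 0) ?mul0r //; ring.
under eq_Rintegral do rewrite f0.
by rewrite /Rintegral integral0 mulr0.
Qed.
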